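(* Under the Combinatorial Dense Triangle Hypothesis, any combinatorial algorithm for $n$-Pairs Minimum Distance on unweighted undirected graphs with approximation ratio better than $2$ requires $n^{3/2-o(1)}$ time on $n$-vertex graphs.
   Context: $n$-Pairs Minimum Distance: given a graph with $n$ vertices and $O(n)$ vertex pairs $(s_i,t_i)$, compute $\min_i d(s_i,t_i)$ (shortest-path distance). Approximation ratio $\alpha$ means the output $\hat x$ satisfies $x\le\hat x\le\alpha x$. ''Combinatorial'' algorithms are those not using fast matrix multiplication. Combinatorial Dense Triangle Hypothesis: in the word-RAM model with $O(\log n)$-bit words, there is no $O(n^{3-\varepsilon})$-time combinatorial algorithm for triangle detection in an $n$-vertex graph, for any constant $\varepsilon>0$. *)

(* Defs.v *)
(* MathComp / MathComp-Analysis. *)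
From mathcomp Require Import all_boot all_order all_algebra.
From mathcomp Require Import classical_sets reals ereal exp.

Set Implicit Arguments.
Unset Strict Implicit.
Unset Printing Implicit Defensive.

Import Order.TTheory GRing.Theory Num.Theory.

(** * Word RAM with [w]-bit words *)

Inductive binop :=
  | Add | Sub | Mul | Div | Mod
  | Shl | Shr | And | Or | Xor
  | Eq | Lt.

(* Arithmetic is modulo [2 ^ w]; [Div] and [Mod] by zero follow [divn], [modn].
   The second operand is assumed to be a word in [Sub]. *)
Definition eval_binop (w : nat) (o : binop) (a b : nat) : nat :=
  (match o with
   | Add => a + b
   | Sub => a + (2 ^ w - b)
   | Mul => a * b
   | Div => a %/ b
   | Mod => a %% b
   | Shl => a * 2 ^ b
   | Shr => a %/ 2 ^ b
   | And => Nat.land a b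
   | Or  => Nat.lor a b
   | Xor => Nat.lxor a b
   | Eq  => a == b
   | Lt  => a < b
   end) %% 2 ^ w.

Inductive expr :=
  | Lit of nat
  | Reg of nat
  | Fetch of expr
  | Bin of binop & expr & expr.

Inductive cmd :=
  | Skip
  | Assign of nat & expr
  | Store of expr & expr
  | Write of expr
  | Seq of cmd & cmd
  | If of expr & cmd & cmd
  | While of expr & cmd.

(* [output] lists the words written so far, most recent first. *)
Record state := State {
  regs : nat -> nat;
  mem : nat -> nat;
  output : seq nat
}.

Definition upd (f : nat -> nat) (i v : nat) : nat -> nat :=
  fun j => if j == i then v else f j.

Fixpoint eval (w : nat) (s : state) (e : expr) : nat :=
  match e with
  | Lit k => k %% 2 ^ w
  | Reg i => regs s i
  | Fetch a => mem s (eval w s a)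
  | Bin o a b => eval_binop w o (eval w s a) (eval w s b)
  end.

(* [exec w c s s' t]: started in [s], [c] halts in [s'] after [t] steps.  Each
   elementary command and each test costs one step: the expressions occurring
   in a fixed program have bounded size, so this agrees with charging for every
   single operation up to a constant factor. *)
Inductive exec (w : nat) : cmd -> state -> state -> nat -> Prop :=
  | ExecSkip s : exec w Skip s s 1
  | ExecAssign s i e :
      exec w (Assign i e) s
        (State (upd (regs s) i (eval w s e)) (mem s) (output s)) 1
  | ExecStore s a e :
      exec w (Store a e) s
        (State (regs s) (upd (mem s) (eval w s a) (eval w s e)) (output s)) 1
  | ExecWrite s e :
      exec w (Write e) s (State (regs s) (mem s) (eval w s e :: output s)) 1
  | ExecSeq c1 c2 s s1 s2 t1 t2 :
      exec w c1 s s1 t1 -> exec w c2 s1 s2 t2 ->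
      exec w (Seq c1 c2) s s2 (t1 + t2)
  | ExecIfTrue e c1 c2 s s' t :
      eval w s e != 0 -> exec w c1 s s' t -> exec w (If e c1 c2) s s' t.+1
  | ExecIfFalse e c1 c2 s s' t :
      eval w s e = 0 -> exec w c2 s s' t -> exec w (If e c1 c2) s s' t.+1
  | ExecWhileFalse e c s :
      eval w s e = 0 -> exec w (While e c) s s 1
  | ExecWhileTrue e c s s1 s2 t1 t2 :
      eval w s e != 0 -> exec w c s s1 t1 -> exec w (While e c) s1 s2 t2 ->
      exec w (While e c) s s2 (t1 + t2).+1.

(* The input occupies the memory cells [0, 1, ..., size x - 1] and register [0]
   holds its length; everything else is zero. *)
Definition init (w : nat) (x : seq nat) : state :=
  State (upd (fun=> 0) 0 (size x %% 2 ^ w))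
        (fun i => nth 0 x i %% 2 ^ w)
        [::].

Definition cmd_runs (w : nat) (c : cmd) (x y : seq nat) (t : nat) : Prop :=
  exists2 s, exec w c (init w x) s t & y = rev (output s).

(* An algorithm is a sequence of phases, the output of a phase being the input
   of the next one, which starts in an otherwise cleared memory.  Since writing
   a word costs one step, merging all phases into a single command changes the
   running time by a constant factor only; concatenation is composition. *)
Definition algorithm := seq cmd.

Fixpoint runs (w : nat) (A : algorithm) (x y : seq nat) (t : nat) : Prop :=
  match A with
  | [::] => y = x /\ t = 0
  | c :: A' => exists z t1 t2,
      [/\ cmd_runs w c x z t1, runs w A' z y t2 & t = t1 + t2]
  end.

Definition bits (n : nat) : nat := (trunc_log 2 n).+1.

(** * Combinatorial algorithms *)

(* Linear time on every input whose words fit in the machine words and whose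
   cells can be addressed. *)
Definition linear_time (c : cmd) : Prop :=
  exists K a : nat, forall (w : nat) (x : seq nat),
    K * bits (size x) <= w -> all (fun v => v < 2 ^ w) x ->
    exists y t, cmd_runs w c x y t /\ t <= a * (size x).+1.

(* "Combinatorial" (not using fast matrix multiplication) has no formal
   definition; it is a predicate [comb] on algorithms of which only the
   following is used.  Phases start in a cleared memory, so a composite of
   linear-time phases is again linear-time: iterating this closure property
   does not bring in any superlinear computation besides that of [A]. *)
Definition closed_under_linear_reductions (comb : algorithm -> Prop) : Prop :=
  forall (pre post : cmd) (A : algorithm),
    linear_time pre -> linear_time post -> comb A ->
    comb (pre :: rcons A post).

(** * Problems and running times *)

Record problem := Problem {
  instance : Type;
  nverts : instance -> nat;
  encoding : instance -> seq nat;
  answer : instance -> seq nat -> Prop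
}.

Local Open Scope ring_scope.

(* [A] is correct on all instances of [P] with [O(log n)]-bit words, and runs in
   time [O(f n)] on the instances with [n] vertices. *)
Definition solves_in_time (R : realType) (P : problem) (A : algorithm)
    (f : nat -> R) : Prop :=
  exists (K n0 : nat) (a : R), forall (w : nat) (x : instance P),
    (K * bits (nverts x) <= w)%N ->
    exists y t, [/\ runs w A (encoding x) y t, answer x y &
      (n0 <= nverts x)%N -> t%:R <= a * f (nverts x)].

(** * Graphs *)

Record sgraph := SGraph {
  gsize : nat;
  adj : rel 'I_gsize;
  adj_sym : symmetric adj;
  adj_irr : irreflexive adj
}.

(* Every edge is listed once, in one of its two orientations; the order of the
   list and the orientations are arbitrary. *)
Definition lists_edges (G : sgraph) (es : seq ('I_(gsize G) * 'I_(gsize G))) :=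
  [/\ uniq es,
      forall u v, (u, v) \in es -> (v, u) \notin es &
      forall u v, adj u v = ((u, v) \in es) || ((v, u) \in es)].

Definition flatten_pairs (n : nat) (s : seq ('I_n * 'I_n)) : seq nat :=
  flatten [seq [:: val p.1; val p.2] | p <- s].

(** * Triangle detection *)

Definition has_triangle (G : sgraph) : bool :=
  [exists u : 'I_(gsize G), exists v : 'I_(gsize G), exists w : 'I_(gsize G),
    [&& adj u v, adj v w & adj u w]].

Record triangle_instance := TriangleInstance {
  tri_graph : sgraph;
  tri_edges : seq ('I_(gsize tri_graph) * 'I_(gsize tri_graph));
  tri_edgesP : lists_edges tri_edges
}.

Definition triangle_detection : problem := {|
  instance := triangle_instance;
  nverts := fun I => gsize (tri_graph I);
  encoding := fun I =>
    [:: gsize (tri_graph I), size (tri_edges I) & flatten_pairs (tri_edges I)];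
  answer := fun I y => y = [:: nat_of_bool (has_triangle (tri_graph I))]
|}.

Definition combinatorial_dense_triangle_hypothesis (R : realType)
    (comb : algorithm -> Prop) : Prop :=
  forall eps : R, 0 < eps ->
    ~ exists2 A, comb A &
        solves_in_time triangle_detection A (fun n => n%:R `^ (3 - eps)).

(** * n-Pairs Minimum Distance *)

(* [+oo] when [t] cannot be reached from [s]. *)
Definition gdist (R : realType) (G : sgraph) (s t : 'I_(gsize G)) : \bar R :=
  ereal_inf [set d | exists p : seq 'I_(gsize G),
    [/\ path (@adj G) s p, last s p = t & d = (size p)%:R%:E]]%classic.

Definition min_dist (R : realType) (G : sgraph)
    (ps : seq ('I_(gsize G) * 'I_(gsize G))) : \bar R :=
  \big[Order.min/+oo%E]_(p <- ps) gdist R p.1 p.2.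

Record npairs_instance (C : nat) (M : nat -> nat) := NPairsInstance {
  np_graph : sgraph;
  np_edges : seq ('I_(gsize np_graph) * 'I_(gsize np_graph));
  np_pairs : seq ('I_(gsize np_graph) * 'I_(gsize np_graph));
  np_edgesP : lists_edges np_edges;
  np_edges_le : (size np_edges <= M (gsize np_graph))%N;
  np_pairs_gt0 : (0 < size np_pairs)%N;
  np_pairs_le : (size np_pairs <= C * gsize np_graph)%N
}.

(* An estimate is a natural number, or [None] for [+oo]. *)
Definition estimate_value (R : realType) (d : option nat) : \bar R :=
  if d is Some k then k%:R%:E else +oo%E.

Definition estimate_encoding (d : option nat) : seq nat :=
  if d is Some k then [:: 1%N; k] else [:: 0%N].

Definition npairs_min_distance (R : realType) (C : nat) (M : nat -> nat)
    (alpha : R) : problem := {|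
  instance := npairs_instance C M;
  nverts := fun I => gsize (np_graph I);
  encoding := fun I =>
    [:: gsize (np_graph I), size (np_edges I), size (np_pairs I)
      & flatten_pairs (np_edges I) ++ flatten_pairs (np_pairs I)];
  answer := fun I y => exists d : option nat,
    [/\ y = estimate_encoding d,
        (min_dist R (np_pairs I) <= estimate_value R d)%E &
        (estimate_value R d <= alpha%:E * min_dist R (np_pairs I))%E]
|}.

(* Main.v *)
(* Take the bipartite double cover of [G], with vertices [u] and [n + u] for
   each vertex [u] of [G], and the pairs [(u, v)] for the edges [uv] of [G].
   Both ends lie on the same side, so their distance is even and nonzero; it is
   2 iff [u] and [v] have a common neighbour, i.e. iff [uv] lies in a triangle,
   and at least 4 otherwise, which a ratio below 2 tells apart.  Isolated
   vertices bring the number of vertices to [N = 2n + 2m + 2 = O(n ^ 2)] for [m]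
   edges, so that the cover, with its [2m] edges, is sparse; they are never
   written out, so the encoding is produced in time [O(m)], and
   [N ^ (3/2 - eps) = O(n ^ (3 - 2 eps))].  *)
Require Import Defs.
From mathcomp Require Import all_boot all_order all_algebra.
From mathcomp Require Import boolp classical_sets reals ereal exp.
From mathcomp Require Import zify lra.

Import Order.TTheory GRing.Theory Num.Theory.
Import Defs.

(** * Word RAM programs *)

Definition words (w : nat) (x : seq nat) : bool := all (fun v => v < 2 ^ w) x.

(** An invariant of execution. It makes every word written by an algorithm smaller than [2 ^ w], so
    that the next phase reads it back unreduced. *)
Definition word_state (w : nat) (s : state) : Prop :=
  [/\ forall i, regs s i < 2 ^ w, forall i, mem s i < 2 ^ w & words w (output s)].

Lemma eval_word w s e : word_state w s -> eval w s e < 2 ^ w.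
Proof.
have w_gt0 : 0 < 2 ^ w by rewrite expn_gt0.
by case=> rw mw _; case: e => [k|i|a|o a b] //=; rewrite ltn_mod.
Qed.

Lemma upd_word w f i v :
  (forall j, f j < 2 ^ w) -> v < 2 ^ w -> forall j, upd f i v j < 2 ^ w.
Proof. by move=> fw vw j; rewrite /upd; case: eqP. Qed.

Lemma exec_word w c s s' t : exec w c s s' t -> word_state w s -> word_state w s'.
Proof.
elim=> {c s s' t}; auto.
- move=> s i e sw; have [rw mw ow] := sw.
  by split=> //=; apply: upd_word => //; apply: eval_word.
- move=> s a e sw; have [rw mw ow] := sw.
  by split=> //=; apply: upd_word => //; apply: eval_word.
- move=> s e sw; have [rw mw ow] := sw.
  by split=> //=; rewrite eval_word.
Qed.

Lemma init_word w x : word_state w (init w x).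
Proof.
have w_gt0 : 0 < 2 ^ w by rewrite expn_gt0.
by split=> // i /=; rewrite ?ltn_mod // upd_word ?ltn_mod.
Qed.

Lemma cmd_runs_words w c x y t : cmd_runs w c x y t -> words w y.
Proof.
case=> s /exec_word /(_ (init_word w x)) [_ _ sw] ->.
by rewrite /words all_rev.
Qed.

Lemma runs_words w A x y t : runs w A x y t -> words w x -> words w y.
Proof.
elim: A x t => [|c A IH] x t /=; first by case=> ->.
by case=> z [t1 [t2 [/cmd_runs_words zw rz _]]] _; exact: IH rz zw.
Qed.

Lemma runs_rcons w A c x y z t t' :
  runs w A x y t -> cmd_runs w c y z t' -> runs w (rcons A c) x z (t + t').
Proof.
elim: A x t => [|d A IH] x t /=.
  by case=> -> -> yz; exists z, t', 0; rewrite addn0.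
case=> u [t1 [t2 [xu uy ->]]] yz; exists u, t1, (t2 + t').
by split; rewrite ?addnA //; exact: IH.
Qed.

(** * Programs that read the input two words at a time *)

Definition writes (es : seq expr) : cmd :=
  foldr (fun e c => Seq (Write e) c) Skip es.

Lemma eval_output w r m o o' e :
  eval w (State r m o) e = eval w (State r m o') e.
Proof.
by elim: e => [k|i|a IHa|b e1 IH1 e2 IH2] //=; rewrite ?IHa ?IH1 ?IH2.
Qed.

Lemma exec_writes w es r m o :
  exec w (writes es) (State r m o)
    (State r m (rev [seq eval w (State r m [::]) e | e <- es] ++ o))
    (size es).+1.
Proof.
elim: es o => [|e es IH] o /=; first exact: ExecSkip.
rewrite -add1n; apply: ExecSeq; first exact: ExecWrite.
rewrite rev_cons cat_rcons /= (eval_output w r m o [::]); exact: IH.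
Qed.

(* Register 0 holds the length of the input, register 1 the current position. *)
Definition loop_state (n : nat) (m : nat -> nat) (i : nat) (o : seq nat) : state :=
  State (upd (upd (fun=> 0) 0 n) 1 i) m o.

Lemma set_position n m i j o :
  State (upd (regs (loop_state n m i o)) 1 j) m o = loop_state n m j o.
Proof.
by congr State; apply: funext => k; rewrite /= /upd; case: eqP.
Qed.

Lemma init_loop_state w x :
  init w x = loop_state (size x %% 2 ^ w) (fun i => nth 0 x i %% 2 ^ w) 0 [::].
Proof.
by congr State; apply: funext => k; rewrite /= /upd; case: k => [|[|]].
Qed.

Definition pair_body (es : seq expr) : cmd :=
  Seq (writes es) (Assign 1 (Bin Add (Reg 1) (Lit 2))).

Definition pair_loop (es : seq expr) : cmd :=
  While (Bin Lt (Reg 1) (Reg 0)) (pair_body es).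

Definition pair_outputs w es n m i k : seq nat :=
  flatten [seq [seq eval w (loop_state n m (i + 2 * j) [::]) e | e <- es]
          | j <- iota 0 k].

Lemma pair_outputsS w es n m i k :
  pair_outputs w es n m i k.+1 =
  [seq eval w (loop_state n m i [::]) e | e <- es] ++
  pair_outputs w es n m (i + 2) k.
Proof.
rewrite /pair_outputs /= muln0 addn0; congr (_ ++ flatten _).
rewrite -[1]/(1 + 0) iotaDl -map_comp; apply: eq_map => j /=.
by rewrite mulnDr muln1 addnA.
Qed.

(** The two bounds on [i + 2 * k] force exactly [k] rounds, the last of which may start at [n - 1];
    [n + 2 < 2 ^ w] keeps the position from wrapping around. A round costs [size es + 1] for the
    writes, 1 for the increment and 1 for the test. *)
Lemma exec_pair_loop w es n m k i o :
  2 <= w -> n + 2 < 2 ^ w -> n <= i + 2 * k -> (0 < k -> i + 2 * k <= n.+1) ->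
  exec w (pair_loop es) (loop_state n m i o)
    (loop_state n m (i + 2 * k) (rev (pair_outputs w es n m i k) ++ o))
    (k * (size es + 3)).+1.
Proof.
move=> w_ge2 nw.
have w_ge4 : 4 <= 2 ^ w by rewrite -[4]/(2 ^ 2) leq_exp2l.
elim: k i o => [|k IH] i o.
  rewrite muln0 addn0 => ni _; apply: ExecWhileFalse => /=.
  by rewrite /upd /eval_binop /= ltnNge ni mod0n.
move=> ni /(_ isT) ik.
have i_lt : i < n by lia.
have -> : (k.+1 * (size es + 3)).+1 =
          ((size es).+2 + (k * (size es + 3)).+1).+1 by lia.
apply: (@ExecWhileTrue _ _ _ _ (loop_state n m (i + 2)
  (rev [seq eval w (loop_state n m i [::]) e | e <- es] ++ o))).
- by rewrite /= /upd /eval_binop /= i_lt modn_small //; lia.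
- rewrite -[(size es).+2]addn1; apply: ExecSeq; first exact: exec_writes.
  rewrite -(set_position n m i); set s := State _ _ _ in |- *.
  have -> : i + 2 = eval w (loop_state n m i (output s)) (Bin Add (Reg 1) (Lit 2)).
    by rewrite /= /upd /eval_binop /= (@modn_small 2) ?modn_small //; lia.
  exact: ExecAssign.
- rewrite pair_outputsS rev_cat -catA.
  have -> : i + 2 * k.+1 = i + 2 + 2 * k by lia.
  by apply: IH; lia.
Qed.

(** * The phase that writes the cover instance *)

Definition npairs_header : seq expr :=
  [:: Bin Add (Bin Mul (Fetch (Lit 0)) (Lit 2)) (Reg 0);
      Bin Mul (Fetch (Lit 1)) (Lit 2);
      Bin Add (Fetch (Lit 1)) (Lit 1)].

Definition npairs_edge : seq expr :=
  let u := Fetch (Reg 1) in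
  let v := Fetch (Bin Add (Reg 1) (Lit 1)) in
  let n := Fetch (Lit 0) in
  [:: u; Bin Add n v; v; Bin Add n u].

Definition npairs_pair : seq expr :=
  [:: Fetch (Reg 1); Fetch (Bin Add (Reg 1) (Lit 1))].

Definition npairs_footer : seq expr :=
  let n := Bin Mul (Fetch (Lit 0)) (Lit 2) in [:: n; Bin Add n (Lit 1)].

(** On a graph with [m] edges register 0 holds [2m + 2], so the first header word is [2n + 2m + 2].
    The edges are read twice, each time from cell 2 on, because the encoding lists all edges before
    all pairs. *)
Definition encode_npairs : cmd :=
  Seq (writes npairs_header)
 (Seq (Assign 1 (Lit 2))
 (Seq (pair_loop npairs_edge)
 (Seq (Assign 1 (Lit 2))
 (Seq (pair_loop npairs_pair)
      (writes npairs_footer))))).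

(* On a malformed input of odd length the loops read one cell past the end,
   hence the [uphalf]. *)
Definition npairs_output (w : nat) (x : seq nat) : seq nat :=
  let m i := nth 0 x i %% 2 ^ w in
  let n := size x in
  let k := uphalf (n - 2) in
  let ev i es := [seq eval w (loop_state n m i [::]) e | e <- es] in
  ev 0 npairs_header ++ pair_outputs w npairs_edge n m 2 k ++
  pair_outputs w npairs_pair n m 2 k ++ ev (2 + 2 * k) npairs_footer.

Lemma encode_npairs_runs w x :
  2 <= w -> size x + 2 < 2 ^ w ->
  exists2 t, cmd_runs w encode_npairs x (npairs_output w x) t &
    t <= 20 * (size x).+1.
Proof.
move=> w_ge2 xw; set n := size x; set k := uphalf (n - 2).
have nk : n <= 2 + 2 * k by rewrite /k /n; lia.
have kn : 0 < k -> 2 + 2 * k <= n.+1 by rewrite /k /n; lia.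
have assign2 i m o : exec w (Assign 1 (Lit 2)) (loop_state n m i o) (loop_state n m 2 o) 1.
  rewrite -(set_position n m i 2).
  have := @ExecAssign w (loop_state n m i o) 1 (Lit 2).
  have -> : eval w (loop_state n m i o) (Lit 2) = 2 by rewrite /= modn_small //; lia.
  exact.
eexists.
  rewrite /cmd_runs init_loop_state (@modn_small (size x)); last by lia.
  eexists.
    apply: ExecSeq; first exact: exec_writes.
    apply: ExecSeq; first exact: assign2.
    apply: ExecSeq; first exact: (exec_pair_loop _ _ _ _ k).
    apply: ExecSeq; first exact: assign2.
    apply: ExecSeq; first exact: (exec_pair_loop _ _ _ _ k).
    exact: exec_writes.
  by cbn [output loop_state]; rewrite !rev_cat !revK -!catA.
(* The six commands take [4 + 1 + (7k + 1) + 1 + (5k + 1) + 3 = 12k + 11] steps, and [2k <= n]. *)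
rewrite /= /n /k; lia.
Qed.

Lemma size_flatten_pairs (n : nat) (es : seq ('I_n * 'I_n)) :
  size (flatten_pairs es) = 2 * size es.
Proof. by rewrite /flatten_pairs; elim: es => //= p es ->; rewrite mulnS. Qed.

(** Turns a loop over positions into a map over the edge list; [F j] need only be computed knowing
    which pair the cells [2j] and [2j + 1] hold. *)
Lemma flatten_map_iota (T : Type) (n : nat) (es : seq ('I_n * 'I_n))
    (F : nat -> seq T) (f : 'I_n * 'I_n -> seq T) :
  (forall j (p : 'I_n * 'I_n), j < size es -> nth 0 (flatten_pairs es) (2 * j) = p.1 ->
     nth 0 (flatten_pairs es) (2 * j).+1 = p.2 -> F j = f p) ->
  flatten [seq F j | j <- iota 0 (size es)] = flatten [seq f p | p <- es].
Proof.
elim: es F => [|p es IH] F //= HF.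
rewrite (HF 0 p) //; congr (_ ++ _).
rewrite -[1]/(1 + 0) iotaDl -map_comp; apply: IH => j q jes q1 q2 /=.
by apply: HF; rewrite // ?mulnS.
Qed.

(** The bound on [2 ^ w] rules out every reduction modulo [2 ^ w], so the loops write the numbers of
    the cover exactly. *)
Lemma npairs_output_edges w n (es : seq ('I_n * 'I_n)) :
  (2 * n + 2 * size es).+2 < 2 ^ w ->
  npairs_output w [:: n, size es & flatten_pairs es] =
  [:: (2 * n + 2 * size es).+2; 2 * size es; (size es).+1] ++
  flatten [seq [:: val p.1; n + p.2; val p.2; n + p.1] | p : 'I_n * 'I_n <- es] ++
  flatten_pairs es ++ [:: 2 * n; (2 * n).+1].
Proof.
move=> nw.
rewrite /npairs_output; set x := [:: n, _ & _].
have x_sz : size x = (2 * size es).+2 by rewrite /= size_flatten_pairs.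
have -> : uphalf (size x - 2) = size es by rewrite x_sz; lia.
rewrite x_sz; set m := fun i => nth 0 x i %% 2 ^ w.
have m0 : m 0 = n by rewrite /m /= modn_small //; lia.
have m1 : m 1 = size es by rewrite /m /= modn_small //; lia.
have fetch j (p : 'I_n * 'I_n) : j < size es ->
    nth 0 (flatten_pairs es) (2 * j) = p.1 ->
    nth 0 (flatten_pairs es) (2 * j).+1 = p.2 ->
    [/\ m (2 + 2 * j) = p.1, m (2 + 2 * j).+1 = p.2,
        p.1 < n, p.2 < n & (2 + 2 * j).+1 < 2 ^ w].
  move=> jes p1 p2; have b1 := ltn_ord p.1; have b2 := ltn_ord p.2.
  by rewrite /m /= p1 p2 !modn_small; try split=> //; lia.
have lit : (0 %% 2 ^ w = 0) * (1 %% 2 ^ w = 1) * (2 %% 2 ^ w = 2).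
  by rewrite mod0n !modn_small //; lia.
clearbody m; congr (_ ++ (_ ++ (_ ++ _))).
- rewrite /= /eval_binop /upd /= !lit m0 m1 !modn_small;
    try congr [:: _; _; _]; lia.
- apply: flatten_map_iota => j p jes p1 p2.
  have [e1 e2 b1 b2 b3] := fetch j p jes p1 p2.
  rewrite /= /eval_binop /upd /= !lit addn1 (modn_small b3) e1 e2 m0.
  by rewrite !modn_small //; lia.
- apply: flatten_map_iota => j p jes p1 p2.
  have [e1 e2 b1 b2 b3] := fetch j p jes p1 p2.
  by rewrite /= /eval_binop /upd /= !lit addn1 (modn_small b3) e1 e2.
- rewrite /= /eval_binop /upd /= !lit m0 !modn_small;
    try congr [:: _; _]; lia.
Qed.

Lemma bits_lt k w : bits k <= w -> k < 2 ^ w.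
Proof.
move=> kw; apply: leq_trans (_ : 2 ^ bits k <= _); last by rewrite leq_exp2l.
exact: trunc_log_ltn.
Qed.

Lemma encode_npairs_linear : linear_time encode_npairs.
Proof.
exists 3, 20 => w x xw _.
have lt_x : size x < 2 ^ bits (size x) by exact: bits_lt.
(* Since [bits] is at least 1, [3 * bits] exceeds [bits + 2] or equals it; the two spare bits make
   room for [size x + 2]. *)
have le_w : 2 ^ (bits (size x) + 2) <= 2 ^ w.
  by rewrite leq_exp2l //; apply: leq_trans xw; rewrite /bits; lia.
have [t xt t_le] : exists2 t, cmd_runs w encode_npairs x (npairs_output w x) t &
    t <= 20 * (size x).+1.
  apply: encode_npairs_runs; first by rewrite /bits in xw; lia.
  by rewrite expnD in le_w; lia.
by exists (npairs_output w x), t.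
Qed.

(** * The phase that reads the estimate *)

Definition decide_triangle : cmd :=
  If (Fetch (Lit 0)) (Write (Bin Lt (Fetch (Lit 1)) (Lit 4))) (Write (Lit 0)).

(** Cell 0 is the flag of [estimate_encoding], where 0 stands for [+oo]; cell 1 is the finite
    estimate. *)
Definition triangle_output (w : nat) (y : seq nat) : seq nat :=
  [:: if nth 0 y 0 %% 2 ^ w == 0 then 0
      else (nth 0 y 1 %% 2 ^ w < 4 : nat)].

Lemma decide_triangle_runs w y :
  3 <= w -> cmd_runs w decide_triangle y (triangle_output w y) 2.
Proof.
move=> w_ge3.
have w_ge8 : 8 <= 2 ^ w by rewrite -[8]/(2 ^ 3) leq_exp2l.
have lit : (0 %% 2 ^ w = 0) * (1 %% 2 ^ w = 1) * (4 %% 2 ^ w = 4).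
  by rewrite mod0n !modn_small //; lia.
rewrite /triangle_output; case: eqP => [y0|/eqP y0].
  exists (State (regs (init w y)) (mem (init w y)) [:: 0 %% 2 ^ w]).
    by apply: ExecIfFalse; [rewrite /= lit | exact: ExecWrite].
  by rewrite /= lit.
eexists; first by apply: ExecIfTrue; [rewrite /= lit | exact: ExecWrite].
by rewrite /= /eval_binop /= !lit; case: (_ < 4); rewrite lit.
Qed.

Lemma decide_triangle_linear : linear_time decide_triangle.
Proof.
exists 3, 2 => w x xw _.
exists (triangle_output w x), 2; split; last by lia.
by apply: decide_triangle_runs; rewrite /bits in xw; lia.
Qed.

(** * The double cover *)

Definition cover_size (G : sgraph) (es : seq ('I_(gsize G) * 'I_(gsize G))) : nat :=
  (2 * gsize G + 2 * size es).+2.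

Section DoubleCover.
Variables (G : sgraph) (es : seq ('I_(gsize G) * 'I_(gsize G))).
Hypothesis esP : lists_edges es.

Local Notation n := (gsize G).
Local Notation N := (cover_size G es).

Definition low (u : 'I_n) : 'I_N := inord u.
Definition high (u : 'I_n) : 'I_N := inord (n + u).

Lemma val_low u : low u = u :> nat.
Proof. by rewrite inordK // /cover_size; have := ltn_ord u; lia. Qed.

Lemma val_high u : high u = n + u :> nat.
Proof. by rewrite inordK // /cover_size; have := ltn_ord u; lia. Qed.

(** [b] selects one of the two lifts of an edge. The low end always comes first, so no listed edge
    occurs reversed. *)
Definition cover_edge (p : 'I_n * 'I_n) (b : bool) : 'I_N * 'I_N :=
  if b then (low p.2, high p.1) else (low p.1, high p.2).

Definition cover_edges : seq ('I_N * 'I_N) :=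
  [seq cover_edge p b | p <- es, b <- [:: false; true]].

(* The last pair joins two isolated vertices: the list is nonempty even when
   [G] has no edge. *)
Definition cover_pairs : seq ('I_N * 'I_N) :=
  rcons [seq (low p.1, low p.2) | p <- es] (inord (2 * n), inord (2 * n).+1).

Lemma low_inj : injective low.
Proof. by move=> u v /(congr1 val) /=; rewrite !val_low => /val_inj. Qed.

Lemma high_inj : injective high.
Proof.
by move=> u v /(congr1 val) /=; rewrite !val_high => /addnI /val_inj.
Qed.

Lemma adj_edges u v : adj u v = ((u, v) \in es) || ((v, u) \in es).
Proof. by case: esP. Qed.

Lemma cover_edgesP x y :
  reflect (exists u v, [/\ adj u v, x = low u & y = high v])
    ((x, y) \in cover_edges).
Proof.
apply: (iffP allpairsP) => [[[[u v] b] /= [uv _]]|[u [v [uv -> ->]]]].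
  case: b => -[-> ->]; [exists v, u | exists u, v];
    by split=> //; rewrite adj_edges uv ?orbT.
move: uv; rewrite adj_edges => /orP[uv|vu].
  by exists ((u, v), false); split.
by exists ((v, u), true); split.
Qed.

(** By injectivity of [low] and [high], equal lifts come from the same listed pair or from two
    opposite ones, and [es] never lists both orientations. *)
Lemma cover_edges_uniq : uniq cover_edges.
Proof.
have [es_uniq es_anti _] := esP.
apply: allpairs_uniq => // -[[u v] b] [[u' v'] b'].
move=> /allpairsP[[p c] [pes _ [puv _]]] /allpairsP[[q d] [qes _ [quv _]]].
move: pes qes; rewrite -puv -quv => uv uv'.
case: b b' => [] [] [] /low_inj e1 /high_inj e2; subst => //.
  by move: (es_anti _ _ uv); rewrite uv'.
by move: (es_anti _ _ uv); rewrite uv'.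
Qed.

Definition cover_adj : rel 'I_N :=
  fun x y => ((x, y) \in cover_edges) || ((y, x) \in cover_edges).

Lemma cover_edges_lt x y : (x, y) \in cover_edges -> x < n <= y.
Proof.
move=> /cover_edgesP[u [v [_ -> ->]]].
by rewrite val_low val_high leq_addr ltn_ord.
Qed.

Lemma cover_adj_sym : symmetric cover_adj.
Proof. by move=> x y; rewrite /cover_adj orbC. Qed.

Lemma cover_adj_irr : irreflexive cover_adj.
Proof.
by move=> x; apply/negP => /orP[] /cover_edges_lt; case: ltnP.
Qed.

Definition double_cover : sgraph := SGraph cover_adj_sym cover_adj_irr.

Lemma cover_edges_listed : @lists_edges double_cover cover_edges.
Proof.
split=> //; first exact: cover_edges_uniq.
move=> x y /cover_edges_lt xy; apply/negP => /cover_edges_lt yx.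
by case/andP: xy; case/andP: yx; case: ltnP; lia.
Qed.

(** * Distances in the cover *)

Lemma cover_adj_low u x : cover_adj (low u) x -> exists2 v, adj u v & x = high v.
Proof.
case/orP => [/cover_edgesP[u' [v [uv /low_inj -> ->]]]|/cover_edges_lt].
  by exists v.
by rewrite val_low; have := ltn_ord u; lia.
Qed.

Lemma cover_adj_high u x : cover_adj (high u) x -> exists2 v, adj u v & x = low v.
Proof.
case/orP => [/cover_edges_lt|/cover_edgesP[v [u' [uv -> /high_inj ->]]]].
  by rewrite val_high; lia.
by exists v; rewrite // adj_sym.
Qed.

Lemma cover_adj_isolated (x y : 'I_N) : 2 * n <= x -> ~~ cover_adj x y.
Proof.
move=> nx; apply/negP => /orP[/cover_edges_lt|/cover_edgesP[v [u [_ _ xu]]]].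
  by lia.
by move: nx; rewrite xu val_high; have := ltn_ord u; lia.
Qed.

Lemma cover_path_ge4 u v p :
  ~~ has_triangle G -> adj u v ->
  path cover_adj (low u) p -> last (low u) p = low v -> 4 <= size p.
Proof.
move=> no_tri uv.
have low_neq_high a b : low a <> high b.
  move=> /(congr1 val) /=; rewrite val_low val_high.
  by have := ltn_ord a; lia.
have no2 w : adj u w -> adj w v -> False.
  move=> uw wv; case/negP: no_tri.
  by apply/existsP; exists u; apply/existsP; exists w; apply/existsP; exists v;
     rewrite uw wv uv.
(* Length 0 would make [u] its own neighbour, lengths 1 and 3 end on a high vertex, and length 2
   yields a common neighbour, hence a triangle. *)
case: p => [|a [|b [|c [|d p]]]] //=.
- by move=> _ /low_inj e; rewrite e adj_irr in uv.
- by case/andP => /cover_adj_low[w _ ->] _ /esym/low_neq_high.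
- case/and3P => /cover_adj_low[w uw ->] /cover_adj_high[z wz ->] _ /low_inj zv.
  by rewrite zv in wz; case: (no2 _ uw wz).
- case/and4P => /cover_adj_low[w _ ->] /cover_adj_high[z _ ->].
  by case/cover_adj_low => t _ -> _ /esym/low_neq_high.
Qed.

Lemma cover_pairs_path_ge4 (s t : 'I_N) p :
  ~~ has_triangle G -> (s, t) \in cover_pairs ->
  path cover_adj s p -> last s p = t -> 4 <= size p.
Proof.
move=> no_tri; rewrite mem_rcons in_cons => /predU1P[[-> ->]|].
  (* The padding pair: the empty path misses the end [2n + 1], and a longer one has no first edge,
     [2n] being isolated. *)
  case: p => [_ /= /(congr1 val)|a p /= /andP[]].
    by rewrite /= !inordK // /cover_size; lia.
  by move=> h; have := @cover_adj_isolated (inord (2 * n)) a;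
     rewrite inordK ?h // /cover_size; lia.
case/mapP => -[u v] uv [-> ->]; apply: cover_path_ge4 => //.
by rewrite adj_edges uv.
Qed.

Lemma cover_path2 : has_triangle G ->
  exists s t p, [/\ (s, t) \in cover_pairs, path cover_adj s p, last s p = t
    & size p = 2].
Proof.
move=> tri.
have [u [v [w [uv uw wv]]]] : exists u v w,
    [/\ (u, v) \in es, adj u w & adj w v].
  case/existsP: tri => u /existsP[v /existsP[w /and3P[uv vw uw]]].
  (* The edge [uw] is listed in one orientation only; in both cases [v] serves as the midpoint. *)
  move: uw; rewrite adj_edges => /orP[uw|wu].
    by exists u, w, v.
  by exists w, u, v; split; rewrite // adj_sym.
exists (low u), (low v), [:: high w; low v]; split=> //.
  by rewrite mem_rcons in_cons; apply/orP; right; apply/mapP; exists (u, v).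
rewrite /= andbT; apply/andP; split; apply/orP; [left|right];
  apply/cover_edgesP; [exists u, w|exists v, w]; split=> //.
by rewrite adj_sym.
Qed.

Lemma gdist_le (R : realType) (s t : 'I_N) p :
  path cover_adj s p -> last s p = t ->
  (@gdist R double_cover s t <= (size p)%:R%:E)%E.
Proof. by move=> sp pt; apply: ereal_inf_lbound; exists p. Qed.

Lemma min_dist_cover_le2 (R : realType) :
  has_triangle G -> (@min_dist R double_cover cover_pairs <= 2%:R%:E)%E.
Proof.
case/cover_path2 => s [t [p [st sp pt p2]]].
apply: le_trans (_ : (@gdist R double_cover s t <= _)%E); last by rewrite -p2; exact: gdist_le.
rewrite /min_dist; elim: cover_pairs st => //= q qs IH; rewrite in_cons big_cons ge_min.
by case/predU1P => [<-|/IH ->]; rewrite ?lexx ?orbT.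
Qed.

Lemma min_dist_cover_ge4 (R : realType) :
  ~~ has_triangle G -> (4%:R%:E <= @min_dist R double_cover cover_pairs)%E.
Proof.
move=> no_tri; rewrite /min_dist big_seq.
apply: le_bigmin => [|[s t] st]; first by rewrite leey.
apply/ereal_infP => _ [p [sp pt ->]].
by rewrite lee_fin ler_nat; exact: cover_pairs_path_ge4 st sp pt.
Qed.

(** * Sizes and encoding of the cover *)

Lemma size_cover_edges : size cover_edges = 2 * size es.
Proof. by rewrite size_allpairs mulnC. Qed.

Lemma size_cover_pairs : size cover_pairs = (size es).+1.
Proof. by rewrite size_rcons size_map. Qed.

Lemma flatten_cover_edges :
  flatten_pairs cover_edges =
  flatten [seq [:: val p.1; n + p.2; val p.2; n + p.1] | p : 'I_n * 'I_n <- es].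
Proof.
rewrite /flatten_pairs /cover_edges.
suff: forall s : seq ('I_n * 'I_n),
  flatten [seq [:: val p.1; val p.2] | p : 'I_N * 'I_N <-
    [seq cover_edge p b | p <- s, b <- [:: false; true]]] =
  flatten [seq [:: val p.1; n + p.2; val p.2; n + p.1] | p : 'I_n * 'I_n <- s] by [].
by elim=> //= p s ->; rewrite !val_low !val_high.
Qed.

Lemma flatten_cover_pairs :
  flatten_pairs cover_pairs = flatten_pairs es ++ [:: 2 * n; (2 * n).+1].
Proof.
rewrite /flatten_pairs /cover_pairs map_rcons flatten_rcons -map_comp.
congr (flatten _ ++ _).
  by apply: eq_map => p /=; rewrite !val_low.
by rewrite /= !inordK // /cover_size; lia.
Qed.

End DoubleCover.

Lemma size_tri_edges (I : triangle_instance) :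
  size (tri_edges I) <= gsize (tri_graph I) ^ 2.
Proof.
have [es_uniq _ _] := tri_edgesP I.
rewrite -(card_uniqP es_uniq); apply: leq_trans (max_card _) _.
by rewrite card_prod !card_ord mulnn.
Qed.

(** * The reduction *)

Definition tri_cover_size (I : triangle_instance) : nat :=
  cover_size (tri_graph I) (tri_edges I).

Definition cover_instance (C : nat) (M : nat -> nat) (C_gt0 : 0 < C)
    (M_ge : forall n, n <= M n) (I : triangle_instance) : npairs_instance C M.
Proof.
refine (@NPairsInstance C M (double_cover (tri_graph I) (tri_edges I) (tri_edgesP I))
  (cover_edges (tri_graph I) (tri_edges I))
  (cover_pairs (tri_graph I) (tri_edges I))
  (cover_edges_listed (tri_graph I) (tri_edges I) (tri_edgesP I)) _ _ _).
(* The [2m] edges are fewer than the [2n + 2m + 2] vertices, so even [M n = n] admits the cover. *)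
- by rewrite size_cover_edges; apply: leq_trans (M_ge _) => /=; rewrite /cover_size; lia.
- by rewrite size_cover_pairs.
- by rewrite size_cover_pairs /= /cover_size; nia.
Defined.

Lemma cover_instance_encoding (R : realType) (alpha : R) C M C_gt0 M_ge w I :
  tri_cover_size I < 2 ^ w ->
  encoding (cover_instance C M C_gt0 M_ge I : instance (npairs_min_distance C M alpha)) =
  npairs_output w (encoding (I : instance triangle_detection)).
Proof.
move=> Nw; rewrite /= npairs_output_edges //.
by rewrite size_cover_edges size_cover_pairs flatten_cover_edges flatten_cover_pairs.
Qed.

(** With [b = bits n], the cover has at most [2n^2 + 2n + 2 <= 2^(2b + 1)] vertices, hence bit
    length at most [2b + 2 <= 4b]: this gives [4 * K]. The extra 4 makes the size fit in a word even
    for [K = 0]. *)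
Lemma tri_cover_size_lt_word K w (I : triangle_instance) :
  (4 * K + 4) * bits (gsize (tri_graph I)) <= w ->
  tri_cover_size I + 2 < 2 ^ w /\ K * bits (tri_cover_size I) <= w.
Proof.
have := size_tri_edges I; rewrite /tri_cover_size /cover_size.
set n := gsize _; set m := size _ => mn Kw.
have n_lt := bits_lt n _ (leqnn _).
have b_gt0 : 0 < bits n by [].
have N_le : (2 * n + 2 * m).+2 <= 2 ^ (2 * bits n + 1).
  have -> : 2 ^ (2 * bits n + 1) = 2 ^ bits n * 2 ^ bits n * 2.
    by rewrite addn1 expnS mulnC mul2n -addnn expnD.
  by nia.
have N_lt : (2 * n + 2 * m).+2 + 2 < 2 ^ (4 * bits n).
  have -> : 4 * bits n = (2 * bits n + 1) + (2 * bits n - 1) by lia.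
  rewrite (expnD 2 (2 * _ + 1)).
  have : 2 ^ 1 <= 2 ^ (2 * bits n - 1) by rewrite leq_exp2l; lia.
  have : 2 ^ 3 <= 2 ^ (2 * bits n + 1) by rewrite leq_exp2l; lia.
  by nia.
split.
  by apply: leq_trans N_lt _; rewrite leq_exp2l //; nia.
have : trunc_log 2 (2 * n + 2 * m).+2 <= 2 * bits n + 1.
  by rewrite -(@trunc_expnK 2 (2 * bits n + 1)) // leq_trunc_log.
by rewrite [X in K * X]/bits; nia.
Qed.

Local Open Scope ring_scope.

Lemma triangle_output_correct (R : realType) C M C_gt0 M_ge (alpha : R) I w y :
  1 <= alpha -> alpha < 2 -> (3 <= w)%N -> words w y ->
  answer (cover_instance C M C_gt0 M_ge I :
            instance (npairs_min_distance C M alpha)) y ->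
  triangle_output w y = [:: nat_of_bool (has_triangle (tri_graph I))].
Proof.
move=> alpha_ge1 alpha_lt2 w_ge3 yw [d [y_d /= d_ge d_le]].
have w_ge8 : (2 ^ 3 <= 2 ^ w)%N by rewrite leq_exp2l.
have alpha_ge0 : (0 <= alpha%:E)%E by rewrite lee_fin; lra.
have [tri|no_tri] := boolP (has_triangle _).
  have d_lt4 : (estimate_value R d < 4%:R%:E)%E.
    apply: le_lt_trans d_le _.
    apply: le_lt_trans (lee_wpmul2l alpha_ge0 (min_dist_cover_le2 _ _ _ R tri)) _.
    by rewrite -EFinM lte_fin; lra.
  case: d d_lt4 {d_ge d_le} y_d => [k|] /=; last by rewrite ltNge leey.
  rewrite lte_fin ltr_nat => k4 ->; rewrite /triangle_output /= !modn_small ?k4 //; lia.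
have d_ge4 := le_trans (min_dist_cover_ge4 _ _ (tri_edgesP I) R no_tri) d_ge.
case: d d_ge4 {d_ge d_le} y_d => [k|] /= d_ge4 y_d; last first.
  by rewrite y_d /triangle_output /= mod0n.
(* Without [kw] an estimate of at least 4 could have a residue modulo [2 ^ w] below 4. *)
move: d_ge4 yw; rewrite y_d lee_fin ler_nat /words /= andbT => k_ge4 /andP[_ kw].
by rewrite /triangle_output /= !modn_small //; [rewrite ltnNge k_ge4 | lia].
Qed.

Lemma cover_time (R : realType) (a eps : R) (n m t : nat) :
  0 < eps -> (0 < n)%N -> (m <= n ^ 2)%N ->
  t%:R <= a * ((2 * n + 2 * m).+2)%:R `^ (3 / 2 - eps) ->
  (20 * (2 * m).+3 + (t + 2))%:R <=
    (102%:R + `|a| * 6%:R `^ (3 / 2)) * n%:R `^ (3 - 2 * Num.min eps (1 / 2)).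
Proof.
move=> eps_gt0 n_gt0 mn t_le; set e := Num.min eps _.
have e_gt0 : 0 < e by rewrite lt_min eps_gt0; lra.
have e_le : e <= eps by rewrite ge_min lexx.
have e_half : e <= 1 / 2 by rewrite ge_min lexx orbT.
have n_ge1 : 1 <= n%:R :> R by rewrite ler1n.
have sq_le : (n ^ 2)%:R <= n%:R `^ (3 - 2 * e) :> R.
  by rewrite natrX -powR_mulrn ?ler_powR //; lra.
have N_le : ((2 * n + 2 * m).+2)%:R `^ (3 / 2 - eps) <=
            6%:R `^ (3 / 2) * n%:R `^ (3 - 2 * e) :> R.
  (* Capping [eps] at [e] only raises the exponent, the base being at least 1, and keeps it
     nonnegative; then [2n + 2m + 2 <= 6n^2]. *)
  apply: le_trans (_ : ((2 * n + 2 * m).+2)%:R `^ (3 / 2 - e) <= _).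
    by apply: ler_powR; [rewrite ler1n | lra].
  apply: le_trans (_ : (6%:R * n%:R ^+ 2) `^ (3 / 2 - e) <= _).
    apply: ge0_ler_powR; rewrite ?nnegrE //; first by lra.
    by rewrite -natrX -natrM ler_nat; nia.
  rewrite powRM ?exprn_ge0 // -powR_mulrn // -powRrM.
  have -> : 2%:R * (3 / 2 - e) = 3 - 2 * e by lra.
  by apply: ler_wpM2r; [exact: powR_ge0 | apply: ler_powR; [rewrite ler1n | lra]].
rewrite mulrDl addnCA natrD addrC; apply: lerD.
  (* The encoding and decision phases cost [40m + 62 <= 102 n^2]. *)
  apply: le_trans (_ : (102 * n ^ 2)%:R <= _); first by rewrite ler_nat; nia.
  by rewrite natrM ler_wpM2l.
apply: le_trans t_le _; rewrite -mulrA; apply: le_trans (_ : `|a| * _ <= _).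
  by apply: ler_wpM2r; [exact: powR_ge0 | exact: ler_norm].
by apply: ler_wpM2l.
Qed.

(* [M] bounds the number of edges of the input graphs: a quadratic [M] gives all
   graphs, a linear one gives sparse graphs. *)
Theorem theorem1 (R : realType) (comb : algorithm -> Prop)
  (comb_closed : closed_under_linear_reductions comb)
  (hyp : combinatorial_dense_triangle_hypothesis R comb)
  (C : nat) (C_gt0 : (0 < C)%N)
  (M : nat -> nat) (M_ge : forall n : nat, (n <= M n)%N)
  (alpha : R) (alpha_ge1 : 1 <= alpha) (alpha_lt2 : alpha < 2)
  (A : algorithm) (A_comb : comb A)
  (eps : R) (eps_gt0 : 0 < eps) :
  ~ solves_in_time (npairs_min_distance C M alpha) A
      (fun n => n%:R `^ (3 / 2 - eps)).
Proof.
move=> [K [n0 [a A_solves]]].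
(* Reading the graph takes quadratic time, hence the exponent must be at least 2
   and [eps] is capped at 1/2. *)
have e_gt0 : 0 < 2 * Num.min eps (1 / 2).
  by rewrite mulr_gt0 ?lt_min ?eps_gt0 //; lra.
apply: (hyp _ e_gt0); exists (encode_npairs :: rcons A decide_triangle).
  exact: comb_closed encode_npairs_linear decide_triangle_linear A_comb.
(* The word size comes from [tri_cover_size_lt_word] and the time constant from [cover_time], which
   needs [n >= 1]. *)
exists (4 * K + 4)%N, (maxn n0 1), (102%:R + `|a| * 6%:R `^ (3 / 2)) => w I Iw.
have [Nw Kw] := tri_cover_size_lt_word _ _ _ Iw.
have w_ge4 : (4 <= w)%N by apply: leq_trans Iw; rewrite /bits; lia.
have [y [t [Ay y_ok t_le]]] := A_solves w (cover_instance C M C_gt0 M_ge I) Kw.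
have szI : size (encoding (I : instance triangle_detection)) = (2 * size (tri_edges I)).+2.
  by rewrite /= size_flatten_pairs.
have [t1 pre_runs t1_le] : exists2 t1, cmd_runs w encode_npairs
    (encoding (I : instance triangle_detection))
    (encoding (cover_instance C M C_gt0 M_ge I : instance (npairs_min_distance C M alpha))) t1 &
    (t1 <= 20 * (2 * size (tri_edges I)).+3)%N.
  rewrite (cover_instance_encoding R alpha C M C_gt0 M_ge w); last by lia.
  rewrite -szI; apply: encode_npairs_runs; first by lia.
  by rewrite szI; move: Nw; rewrite /tri_cover_size /cover_size; lia.
have yw : words w y by exact: runs_words Ay (cmd_runs_words _ _ _ _ _ pre_runs).
have post_runs := decide_triangle_runs w y (ltnW w_ge4).
rewrite (triangle_output_correct _ _ _ _ _ _ _ _ _ alpha_ge1 alpha_lt2 (ltnW w_ge4) yw y_ok)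
  in post_runs.
exists [:: nat_of_bool (has_triangle (tri_graph I))], (t1 + (t + 2))%N; split=> //.
  by do 3!eexists; split; [exact: pre_runs | exact: runs_rcons Ay post_runs |].
rewrite geq_max => /andP[n0_le n_gt0].
apply: le_trans (cover_time _ _ _ _ _ _ eps_gt0 n_gt0 (size_tri_edges I) (t_le _)).
  by rewrite ler_nat leq_add2r.
(* The time bound of [A] applies because the cover has at least as many vertices as the graph. *)
by apply: leq_trans n0_le _; rewrite /= /cover_size; lia.
Qed.
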